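(* Let $s\ge3$ be an integer and $\psi_s(z):=z^{s-1}(z+s)-(s-1)^{s-1}$. Every nontrivial root $\alpha$ of $\psi_s$ has degree as an algebraic number $$\deg\alpha>\delta(s):=\frac{(\log p_s)(s-1)}{1+\log(s-1)},$$ where $p_s$ is the least prime factor of $s-1$.
   Context: When $s$ is odd, $z=1-s$ is a (double) root of $\psi_s$, called trivial; all other roots are called nontrivial. When $s$ is even, all roots of $\psi_s$ are called nontrivial. *)

(* Defs.v *)
From Stdlib Require Import Reals.
From mathcomp Require Import all_boot all_order all_algebra all_field.
Set Implicit Arguments. Unset Strict Implicit. Unset Printing Implicit Defensive.
Import GRing.Theory Num.Theory.

Definition psi (s : nat) : {poly algC} :=
  ('X ^+ (s.-1) * ('X + (s%:R)%:P) - (((s.-1) ^ (s.-1))%N%:R)%:P)%R.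

Definition nontrivial_root (s : nat) (alpha : algC) : Prop :=
  root (psi s) alpha /\ ~ (odd s /\ alpha = (1 - s%:R)%R).

Definition alg_degree (alpha : algC) : nat := (size (minCpoly alpha)).-1.

Definition delta (s : nat) : R :=
  Rdiv (Rmult (ln (INR (pdiv (s.-1)))) (INR (s.-1))) (Rplus R1 (ln (INR (s.-1)))).

(* Main.v *)
(** Put [n = s - 1] and let [a] run over the [d] conjugates of [alpha].  The
    numbers [g = n / a] are algebraic integers: [g ^ n.+1 = n.+1 * g + n], and
    [g ^ n = a + s].  The integer [N = \prod g] divides [n ^ d].

    If [|N| > 1] then [|N|] is at least the least prime factor [p] of [n], so
    [p ^ n <= \prod |a + s| <= (2 n + 1) ^ d < (e n) ^ d], which is the claim.

    The case [|N| = 1] is impossible.  Then [\prod |a + s| = 1], whereas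
    [\prod |a + n| = n ^ d |\prod (1 + g)| >= n ^ d], as no conjugate is [- n].
    If [|g| >= 1] then [|a| <= n], so [|a + n| <= |a + s|]; hence some [g0] has
    [|g0| < 1].  There is only one such root of [X ^ n.+1 = n.+1 X + n], and the
    two products give [n ^ 2 |g0| ^ n <= 1 + |g0| ^ n], which contradicts
    [|g0| > (n - 1) / (n + 1)]. *)

Require Import Defs.
From Stdlib Require Import Reals Lra.
From mathcomp Require Import all_boot all_order all_algebra all_field.
From mathcomp Require Import zify ring.

Import Order.TTheory GRing.Theory Num.Theory.

(** * Conjugates of an algebraic number and rational products over them *)

Section Conjugates.

Local Open Scope ring_scope.

(** Write [p = r * q] with [q] minimal for [y]. If [x] were a root of [r], then [p] would divide a
    nonzero polynomial of smaller degree; so [p] divides [q], and both are monic. *)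
Lemma minCpoly_conj (x y : algC) :
  root (minCpoly x) y -> minCpoly y = minCpoly x.
Proof.
have [p [-> mon_p] div_p] := minCpolyP x.
have [q [Dq mon_q] div_q] := minCpolyP y.
rewrite div_q Dq => /[dup] q_dv_p /dvdpP[r Dp].
have nz_p : p != 0 by exact: monic_neq0.
have [nz_q nz_r] : q != 0 /\ r != 0.
  by split; apply: contraNneq nz_p => Z; rewrite Dp Z ?mulr0 ?mul0r.
have : root (map_poly ratr p) x by rewrite div_p.
rewrite {1}Dp rmorphM rootM !div_p => /orP[/dvdp_leq|p_dv_q]; last first.
  by congr map_poly; apply/eqP; rewrite -eqp_monic // /eqp q_dv_p.
move=> /(_ nz_r); rewrite Dp size_mul //.
have := size_minCpoly y; rewrite Dq size_map_poly.
by move: (size r) (size q) (size_poly_gt0 r) => ? ?; rewrite nz_r; lia.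
Qed.

(** At a root [y] shared with the derivative, the minimal polynomial of [y] would divide its own
    derivative, which is nonzero in characteristic 0 and of smaller degree. *)
Lemma minCpoly_separable (x : algC) : separable_poly (minCpoly x).
Proof.
rewrite separable_poly.unlock; apply: Pdiv.ClosedField.root_coprimep => y.
move/minCpoly_conj=> <-; rewrite -/(root _ y).
have [p [Dp mon_p] div_p] := minCpolyP y.
rewrite Dp deriv_map div_p; apply: contraL (lt_size_deriv (monic_neq0 mon_p)).
rewrite -leqNgt => /dvdp_leq; apply.
have p_gt1 : (1 < size p)%N.
  by have := size_minCpoly y; rewrite Dp size_map_poly.
apply/eqP => /(congr1 (fun q : {poly rat} => q`_(size p).-2)); apply/eqP.
rewrite coef_deriv coef0 -subn2 subnSK // subn1 -/(lead_coef p).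
by rewrite (monicP mon_p) pnatr_eq0 -lt0n -subn1 subn_gt0.
Qed.

Lemma minCpoly_roots (x : algC) :
  {rs : seq algC | [/\ minCpoly x = \prod_(z <- rs) ('X - z%:P), uniq rs,
                       size rs = alg_degree x & x \in rs]}.
Proof.
have [rs] := closed_field_poly_normal (minCpoly x).
rewrite (monicP (minCpoly_monic x)) scale1r => Drs; exists rs; split => //.
- by rewrite -separable_prod_XsubC -Drs minCpoly_separable.
- by rewrite /alg_degree Drs size_prod_XsubC.
- by rewrite -root_prod_XsubC -Drs root_minCpoly.
Qed.

Lemma minCpoly_horner_Crat (x c : algC) : c \in Crat -> (minCpoly x).[c] \in Crat.
Proof.
have [p [-> _] _] := minCpolyP x; case/CratP=> a ->.
by rewrite horner_map /= Crat_rat.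
Qed.

(** Up to sign, the product is the value of [minCpoly x] at [- c]. *)
Lemma prod_addr_conj_Crat (x c : algC) (rs : seq algC) :
  minCpoly x = \prod_(z <- rs) ('X - z%:P) -> c \in Crat ->
  \prod_(z <- rs) (z + c) \in Crat.
Proof.
move=> Drs c_rat; have := minCpoly_horner_Crat x (- c).
rewrite rpredN Drs horner_prod => /(_ c_rat).
move=> prod_rat; rewrite (eq_bigr (fun z => -1 * (- c - z))); last first.
  by move=> z _; rewrite mulN1r opprB opprK.
rewrite big_split; apply: rpredM; first by apply: rpred_prod => z _; rewrite rpredN1.
by under eq_bigr => z _ do rewrite -hornerXsubC.
Qed.

Lemma root_conj_rat (q : {poly rat}) (x y : algC) :
  root (map_poly ratr q) x -> root (minCpoly x) y -> root (map_poly ratr q) y.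
Proof.
move=> qx /minCpoly_conj; have [p [-> _] div_p] := minCpolyP x.
have [r [-> _] div_r] := minCpolyP y => /map_poly_inj Drp.
by rewrite div_r Drp -div_p.
Qed.

Lemma Crat_conj_eq (c x : algC) : c \in Crat -> root (minCpoly x) c -> x = c.
Proof.
case/CratP=> r -> root_r; pose q : {poly rat} := 'X - r%:P.
have root_q y : root (map_poly ratr q) y = (y == ratr r :> algC).
  by rewrite rmorphB /= map_polyX map_polyC root_XsubC.
apply/eqP; rewrite -root_q; apply: (@root_conj_rat q (ratr r)).
  by rewrite root_q.
by rewrite (minCpoly_conj _ _ root_r) root_minCpoly.
Qed.

End Conjugates.

(** * Roots of [psi], their reciprocals [n / a], and the integer bound on the degree *)

Section Roots.

Local Open Scope ring_scope.

Lemma root_psi n (a : algC) :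
  root (psi n.+1) a = (a ^+ n * (a + n.+1%:R) == n%:R ^+ n).
Proof. by rewrite /psi rootE !hornerE subr_eq0 natrX. Qed.

Lemma root_psi_conj s (x y : algC) :
  root (psi s) x -> root (minCpoly x) y -> root (psi s) y.
Proof.
have -> : psi s = map_poly ratr
    ('X ^+ s.-1 * ('X + s%:R%:P) - (s.-1 ^ s.-1)%N%:R%:P) :> {poly algC}.
  rewrite rmorphB rmorphM rmorphD /= map_polyXn map_polyX !map_polyC /=.
  by rewrite !rmorph_nat /psi !polyC_natr.
exact: root_conj_rat.
Qed.

Lemma psi_root_neq0 n (a : algC) : (0 < n)%N -> root (psi n.+1) a -> a != 0.
Proof.
rewrite root_psi => n_gt0; apply: contraTneq => ->.
by rewrite expr0n eqn0Ngt n_gt0 mul0r eq_sym -natrX pnatr_eq0 expn_eq0 eqn0Ngt n_gt0.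
Qed.

Lemma recip_exp n (a : algC) : (0 < n)%N -> root (psi n.+1) a ->
  (n%:R / a) ^+ n = a + n.+1%:R.
Proof.
move=> n_gt0 pa; have nz_a := psi_root_neq0 n a n_gt0 pa.
move: pa; rewrite root_psi => /eqP Ea.
by rewrite expr_div_n -Ea mulrC mulKf // expf_neq0.
Qed.

Lemma recip_expS n (a : algC) : (0 < n)%N -> root (psi n.+1) a ->
  (n%:R / a) ^+ n.+1 = n.+1%:R * (n%:R / a) + n%:R.
Proof.
move=> n_gt0 pa; have nz_a := psi_root_neq0 n a n_gt0 pa.
by rewrite exprS recip_exp // mulrDr divfK // addrC mulrC.
Qed.

Lemma recip_Aint n (a : algC) : (0 < n)%N -> root (psi n.+1) a ->
  n%:R / a \in Aint.
Proof.
move=> n_gt0 pa; pose l : {poly algC} := n.+1%:R *: 'X + n%:R%:P.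
have size_l : (size l < n.+2)%N.
  rewrite (leq_ltn_trans (size_polyD _ _)) // gtn_max.
  rewrite (leq_ltn_trans (size_scale_leq _ _)) ?size_polyX //=.
  by rewrite (leq_ltn_trans (size_polyC_leq1 _)).
apply: (@root_monic_Aint ('X^(n.+1) - l)).
- by rewrite rootE hornerD hornerN hornerXn hornerD hornerZ hornerX hornerC
          recip_expS // subrr.
- by rewrite monicE lead_coefDl ?lead_coefXn // size_polyN size_polyXn.
- apply/polyOverP => i; rewrite coefB coefXn coefD coefZ coefX coefC.
  by rewrite rpredB ?rpredD ?rpredM ?rpred_nat //; case: ifP; rewrite ?rpred_nat ?rpred0.
Qed.

(** Substituting [- n] in the equation leaves [(-1) ^ n = 1]. So [n] is even, [s = n.+1] is odd, and
    [- n = 1 - s] is the trivial root. *)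
Lemma nontrivial_root_addn_neq0 n (a : algC) : (1 < n)%N -> nontrivial_root n.+1 a ->
  a + n%:R != 0.
Proof.
move=> n_gt1 [pa nt_a]; apply/negP; rewrite addr_eq0 => /eqP Da.
move: pa; rewrite root_psi Da -addn1 natrD addKr mulr1 exprNn.
have nz_nn : (n%:R ^+ n : algC) != 0 by rewrite -natrX pnatr_eq0 expn_eq0 eqn0Ngt (ltnW n_gt1).
rewrite -subr_eq0 -{2}[n%:R ^+ n]mul1r -mulrBl mulf_eq0 (negPf nz_nn) orbF subr_eq0.
rewrite -signr_odd; case: (boolP (odd n)) => [_|even_n _].
  by rewrite eq_sym -subr_eq0 opprK -(natrD _ 1 1) pnatr_eq0.
by apply: nt_a; split; rewrite //= Da -addn1 natrD opprD addrCA subrr addr0.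
Qed.

(** Both sides have the same imaginary part, and ['Re a >= - n] makes both real parts
    nonnegative. *)
Lemma norm_addS_le n (a : algC) : `|a| <= n%:R -> `|a + n%:R| <= `|a + n.+1%:R|.
Proof.
move=> a_le_n; rewrite -ler_sqr ?nnegrE ?normr_ge0 //.
have Re_a : - n%:R <= 'Re a.
  rewrite lerNl -raddfN; apply: le_trans a_le_n.
  by rewrite -normrN; have [] := leif_Re_Creal (- a).
have ReImn m : ('Re (m%:R : algC) = m%:R) * ('Im (m%:R : algC) = 0).
  by split; [apply: Creal_ReP (realn _ m) | apply: Creal_ImP (realn _ m)].
rewrite !normC2_Re_Im !raddfD /= !ReImn lerD2r.
have ge0 : 0 <= 'Re a + n%:R by rewrite -lerBlDr sub0r.
have le_S : 'Re a + n%:R <= 'Re a + n.+1%:R by rewrite lerD2l ler_nat.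
by rewrite ler_sqr ?nnegrE // (le_trans ge0).
Qed.

Lemma norm_addS_bound n (a : algC) : (0 < n)%N -> root (psi n.+1) a ->
  `|a + n.+1%:R| <= (2 * n + 1)%N%:R.
Proof.
move=> n_gt0 pa.
have [a_le_n|n_lt_a] := real_leP (normr_real a) (realn _ n).
  rewrite (le_trans (ler_normD _ _)) // normr_nat -addn1 mul2n -addnn -addnA.
  by rewrite [in leRHS]natrD lerD.
(* When [|a| > n], the reciprocal [g = n / a] lies in the unit disc, so
   [|a + n.+1| = |g| ^ n <= 1]. *)
apply: (@le_trans _ _ 1); last by rewrite ler1n; lia.
rewrite -recip_exp // normrX exprn_ile1 // normrM normfV normr_nat.
by rewrite ler_pdivrMr ?mul1r ?ltW // (le_lt_trans _ n_lt_a).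
Qed.

(** Serves the lower bound on a root in the unit disc. Induction starts from the equality
    [4 ^ 2 = 2 ^ 4]; the inequality fails for [m = 1]. *)
Lemma expn_add2_le m : (1 < m)%N -> ((m + 2) ^ m <= m ^ (m + 2))%N.
Proof.
case: m => [//|] [//|m] _; elim: m => [//|m]; set k := m.+2 => IHm.
rewrite -[m.+3]/k.+1; have k_gt0 : (0 < k ^ k.+1)%N by rewrite expn_gt0.
(* Multiply by [k ^ k.+1] and use [(k + 3) k <= (k + 1) (k + 2)]. *)
rewrite -(leq_pmul2r k_gt0) -expnMn.
apply: (@leq_trans ((k.+1 * (k + 2)) ^ k.+1)); first by rewrite leq_exp2r //; lia.
rewrite expnMn expnD -mulnA leq_mul2l; apply/orP; right.
apply: (@leq_trans ((k + 2) * k ^ (k + 2))); first by rewrite expnS leq_mul2l IHm orbT.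
rewrite addn2 [(k ^ k.+2)%N]expnS mulnA leq_mul2r; apply/orP; right.
by rewrite expnS expn1; lia.
Qed.

(** For [x != y], dividing the difference of the equations by [x - y] gives
    [\sum x ^ (n - i) * y ^ i = n.+1]. All [n.+1] terms have norm at most 1, and the term [x ^ n]
    has norm below 1. *)
Lemma disc_root_unique n (x y : algC) : (0 < n)%N ->
  `|x| < 1 -> `|y| < 1 ->
  x ^+ n.+1 = n.+1%:R * x + n%:R -> y ^+ n.+1 = n.+1%:R * y + n%:R -> x = y.
Proof.
move=> n_gt0 x_lt1 y_lt1 Ex Ey; apply/eqP; rewrite -subr_eq0; apply: contraT.
move=> nz_xy; have := subrXX x y n.+1.
rewrite Ex Ey opprD addrACA subrr addr0 -mulrBr mulrC => /(mulfI nz_xy) Esum.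
suff: `|\sum_(i < n.+1) x ^+ (n.+1.-1 - i) * y ^+ i| < n.+1%:R.
  by rewrite -Esum normr_nat ltxx.
rewrite big_ord_recl /= (le_lt_trans (ler_normD _ _)) // -addn1 addnC natrD.
apply: ltr_leD.
  by rewrite subn0 expr0 mulr1 normrX exprn_ilt1 // -lt0n.
apply: le_trans (ler_norm_sum _ _ _) _.
rewrite -[n in leRHS]card_ord -sumr_const ler_sum // => i _.
by rewrite normrM !normrX mulr_ile1 ?exprn_ge0 ?exprn_ile1 // ltW.
Qed.

Lemma disc_root_lower n (g : algC) : (1 < n)%N -> `|g| < 1 ->
  g ^+ n.+1 = n.+1%:R * g + n%:R -> 1 + `|g| ^+ n < n%:R ^+ 2 * `|g| ^+ n.
Proof.
move=> n_gt1 g_lt1 Eg; have [Dn | n_neq2] := eqVneq n 2%N.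
  (* [X^3 - 3 X - 2 = (X + 1)^2 (X - 2)] has no root in the open disc. *)
  have : (g + 1) ^+ 2 * (g - 2%:R) = 0.
    transitivity (g ^+ 3 - (3%:R * g + 2%:R)); first by ring.
    by move: Eg; rewrite Dn => ->; rewrite subrr.
  move/eqP; rewrite mulf_eq0 expf_eq0 /= subr_eq0 addr_eq0.
  by case/orP=> /eqP Dg; move: g_lt1; rewrite Dg ?normrN ?normr1 ?normr_nat
    ?ltrn1 ?ltxx.
case: n n_gt1 Eg n_neq2 => [//|m] m_gt0 Eg m_neq1.
have m_gt1 : (1 < m)%N by lia.
(* With [n = m.+1], the equation gives [m + 1 <= |g| ^ (m + 2) + (m + 2) |g|], and the first summand
   is below 1. *)
have lb : m%:R < (m + 2)%:R * `|g|.
  have : m.+1%:R = `|g ^+ m.+2 - (m + 2)%:R * g|.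
    by rewrite Eg addn2 addrAC subrr add0r normr_nat.
  move=> E; have := ler_normB (g ^+ m.+2) ((m + 2)%:R * g).
  rewrite -E normrX [`|_ * g|]normrM normr_nat -addn1 natrD addrC -lerBrDl.
  move/le_lt_trans; apply; rewrite addrAC -[ltRHS]add0r ltrD2r subr_lt0.
  by rewrite exprn_ilt1.
have : (m%:R : algC) ^+ m.+1 < ((m + 2)%:R * `|g|) ^+ m.+1.
  by rewrite ltrXn2r // ?nnegrE ?mulr_ge0.
(* This is [expn_add2_le] times [m + 2]. With [lb] raised to the power [m.+1] it yields
   [1 < m (m + 2) |g| ^ n], where [m (m + 2) = n ^ 2 - 1]. *)
have : ((m + 2) ^ m.+1 <= m ^ m.+1 * (m * (m + 2)))%N.
  rewrite expnS mulnA [leqRHS]mulnC leq_mul2l -expnSr -[m.+2]addn2.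
  by rewrite expn_add2_le ?orbT.
rewrite -(ler_nat algC) natrM !natrX exprMn => le_nat lt_g.
have := lt_le_trans lt_g (ler_wpM2r (exprn_ge0 m.+1 (normr_ge0 g)) le_nat).
have m_pos : 0 < (m%:R : algC) ^+ m.+1 by rewrite exprn_gt0 // ltr0n ltnW.
rewrite -mulrA -{1}[_ ^+ m.+1]mulr1 ltr_pM2l // => lt_1.
have -> : m.+1%:R ^+ 2 = 1 + (m * (m + 2))%:R :> algC.
  by rewrite -natrX -(natrD _ 1); congr _%:R; lia.
by rewrite mulrDl mul1r addrC ltrD2l.
Qed.

Lemma recip_norm_unit_absurd n (rs : seq algC) : (1 < n)%N ->
  (0 < size rs)%N -> uniq rs -> {in rs, forall a, root (psi n.+1) a} ->
  \prod_(a <- rs) `|n%:R / a| = 1 ->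
  ~ n%:R ^+ size rs <= \prod_(a <- rs) `|a + n%:R|.
Proof.
move=> n_gt1 rs_gt0 uniq_rs psi_rs prod1 prod_ge.
have n_gt0 := ltnW n_gt1.
have n_pos : 0 < (n%:R : algC) by rewrite ltr0n.
have small_le (r : seq algC) : {in r, forall a, `|a| <= n%:R} ->
    \prod_(a <- r) `|a + n%:R| <= \prod_(a <- r) `|a + n.+1%:R|.
  move=> r_le; rewrite big_seq [leRHS]big_seq; apply: ler_prod => a a_r.
  by rewrite normr_ge0 norm_addS_le ?r_le.
have prodS1 : \prod_(a <- rs) `|a + n.+1%:R| = 1.
  transitivity ((\prod_(a <- rs) `|n%:R / a|) ^+ n); last by rewrite prod1 expr1n.
  rewrite -prodrXl big_seq [RHS]big_seq.
  by apply: eq_bigr => a a_rs; rewrite -recip_exp ?psi_rs // normrX.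
(* If every [|a| <= n], then [n ^ d <= \prod |a + n| <= \prod |a + n.+1| = 1], which is absurd for
   [n > 1]. *)
have [/hasP[a0 a0_rs a0_gt] | /hasPn all_le] :=
    boolP (has (fun a => n%:R < `|a|) rs); last first.
  have le1 : n%:R ^+ size rs <= 1 :> algC.
    rewrite (le_trans prod_ge) // -[leRHS]prodS1 small_le // => a /all_le.
    by rewrite -real_leNgt ?normr_real ?realn.
  move: le1; rewrite -natrX lern1 leqNgt (leq_trans n_gt1) //.
  by rewrite -[leqLHS]expn1 leq_pexp2l.
have recip_lt1 (a : algC) : n%:R < `|a| -> `|n%:R / a| < 1.
  move=> a_gt; rewrite normrM normfV normr_nat ltr_pdivrMr ?mul1r //.
  exact: lt_trans a_gt.
have others_le : {in rem a0 rs, forall a, `|a| <= n%:R}.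
  move=> a; rewrite mem_rem_uniq // inE => /andP[a_neq a_rs].
  rewrite real_leNgt ?normr_real ?realn //; apply: contra a_neq => a_gt.
  have : n%:R / a = n%:R / a0.
    by apply: (disc_root_unique n); rewrite ?recip_lt1 ?recip_expS ?psi_rs.
  by move/(mulfI (lt0r_neq0 n_pos))/invr_inj->.
(* With [a0] alone, [prod1] would read [|n / a0| = 1]. Two roots are needed to replace [n ^ d] by
   [n ^ 2] below. *)
have size_ge2 : (1 < size rs)%N.
  have := size_rem a0_rs; have := recip_lt1 _ a0_gt; move: prod1.
  rewrite (big_rem a0) //=; case: (rem a0 rs) => [|b r] /=; last by lia.
  by rewrite big_nil mulr1 => ->; rewrite ltxx.
pose G := `|n%:R / a0| ^+ n.
have DG : `|a0 + n.+1%:R| = G by rewrite -recip_exp ?psi_rs // normrX.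
have G_ge0 : 0 <= G by rewrite exprn_ge0.
have := disc_root_lower n _ n_gt1 (recip_lt1 _ a0_gt)
   (recip_expS n a0 n_gt0 (psi_rs _ a0_rs)).
rewrite -/G; apply/negP; rewrite -real_leNgt ?ger0_real ?addr_ge0 ?mulr_ge0 ?exprn_ge0 //.
move: prodS1 prod_ge; rewrite !(big_rem a0 a0_rs) /= DG => prodS1 prod_ge.
(* The chain is [n ^ 2 G <= n ^ d G <= |a0 + n| G \prod |y + n| <= |a0 + n| G \prod |y + n.+1| = |a0
   + n| <= 1 + G], with products over the roots other than [a0]. *)
apply: (@le_trans _ _ (n%:R ^+ size rs * G)).
  by rewrite ler_wpM2r // -!natrX ler_nat leq_exp2l.
apply: (le_trans (ler_wpM2r G_ge0 prod_ge)).
rewrite mulrAC.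
apply: (@le_trans _ _ (`|a0 + n%:R| * G * \prod_(y <- rem a0 rs) `|y + n.+1%:R|)).
  by rewrite ler_wpM2l ?mulr_ge0 // small_le.
rewrite -mulrA prodS1 mulr1 -DG.
have -> : a0 + n%:R = (a0 + n.+1%:R) - 1 by rewrite -addn1 natrD addrA addrK.
by rewrite (le_trans (ler_normD _ _)) // normrN1 addrC.
Qed.

(** A rational algebraic integer is an integer. Rationality of the second product comes from
    [1 + n / a = (a + n) (n / a) / n]. *)
Lemma conj_recip_prod_int n (x : algC) (rs : seq algC) : (0 < n)%N ->
  minCpoly x = \prod_(z <- rs) ('X - z%:P) ->
  {in rs, forall a, root (psi n.+1) a} ->
  [/\ \prod_(a <- rs) (n%:R / a) \is a Num.int &
      \prod_(a <- rs) (1 + n%:R / a) \is a Num.int].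
Proof.
move=> n_gt0 Dx psi_rs.
have rat_recip : \prod_(a <- rs) (n%:R / a) \in Crat.
  rewrite big_split prodfV /= rpredM ?rpredV //.
    by apply: rpred_prod => a _; rewrite rpred_nat.
  by have := prod_addr_conj_Crat x 0 rs Dx (rpred0 _); under eq_bigr do rewrite addr0.
have nz_n : (n%:R : algC) != 0 by rewrite pnatr_eq0 -lt0n.
have Eprod : \prod_(a <- rs) (1 + n%:R / a) =
    (\prod_(a <- rs) (a + n%:R)) * (\prod_(a <- rs) (n%:R / a)) / 
       \prod_(a <- rs) n%:R.
  rewrite -prodfV -!big_split big_seq [RHS]big_seq; apply: eq_bigr => a a_rs /=.
  have nz_a : a != 0 by rewrite (psi_root_neq0 n) ?psi_rs.
  by field; rewrite nz_a nz_n.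
split; apply: Cint_rat_Aint => //.
- by rewrite big_seq rpred_prod // => a a_rs; rewrite recip_Aint ?psi_rs.
- rewrite Eprod rpredM ?rpredV ?rpredM //.
    by apply: prod_addr_conj_Crat Dx _; rewrite rpred_nat.
  by apply: rpred_prod => a _; rewrite rpred_nat.
- rewrite big_seq rpred_prod // => a a_rs.
  by rewrite rpredD ?rpred1 // recip_Aint ?psi_rs.
Qed.

Lemma pdiv_exp_le_degree n (x : algC) : (1 < n)%N -> nontrivial_root n.+1 x ->
  (pdiv n ^ n <= (2 * n + 1) ^ alg_degree x)%N.
Proof.
move=> n_gt1 nt_x; have n_gt0 := ltnW n_gt1.
have [rs [Dx uniq_rs <- x_rs]] := minCpoly_roots x.
have root_rs a : a \in rs -> root (minCpoly x) a by rewrite Dx root_prod_XsubC.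
have psi_rs : {in rs, forall a, root (psi n.+1) a}.
  by move=> a /root_rs; apply: root_psi_conj; case: nt_x.
have nz_rs : {in rs, forall a, a != 0}.
  by move=> a /psi_rs; apply: psi_root_neq0.
have rs_gt0 : (0 < size rs)%N by case: (rs) x_rs.
have nz_n : (n%:R : algC) != 0 by rewrite pnatr_eq0 -lt0n.
have [int_g int_1g] := conj_recip_prod_int n x rs n_gt0 Dx psi_rs.
set N := \prod_(a <- rs) (n%:R / a) in int_g.
have prod_nE : \prod_(a <- rs) (n%:R : algC) = n%:R ^+ size rs.
  by rewrite big_const_seq count_predT iter_mulr_1.
have int_a : \prod_(a <- rs) a \is a Num.int.
  apply: Cint_rat_Aint.
    have := prod_addr_conj_Crat x 0 rs Dx (rpred0 _).
    by under eq_bigr do rewrite addr0.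
  rewrite big_seq rpred_prod // => a a_rs.
  (* Here [a = g ^ n - n.+1] with [g = n / a], so [a] is an algebraic integer as well. *)
  rewrite -[a](addrK n.+1%:R) -recip_exp ?psi_rs //.
  by rewrite rpredB ?rpredX ?recip_Aint ?psi_rs ?rpred_nat.
have N_dvd : N * \prod_(a <- rs) a = n%:R ^+ size rs.
  rewrite -prod_nE -big_split big_seq [RHS]big_seq.
  by apply: eq_bigr => a a_rs /=; rewrite divfK ?nz_rs.
have /natrP[M DM] := natr_norm_int int_g.
have /natrP[K DK] := natr_norm_int int_a.
have M_dvd : (M * K = n ^ size rs)%N.
  apply/eqP; rewrite -(eqr_nat algC) natrM natrX -DM -DK -normrM N_dvd.
  by rewrite normrX normr_nat.
have M_gt0 : (0 < M)%N.
  by move: (expn_gt0 n (size rs)); rewrite -M_dvd n_gt0 muln_gt0 => /andP[].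
have prodS : \prod_(a <- rs) `|a + n.+1%:R| = (M ^ n)%:R :> algC.
  rewrite natrX -DM /N normr_prod -prodrXl big_seq [RHS]big_seq.
  by apply: eq_bigr => a a_rs; rewrite -recip_exp ?psi_rs // normrX.
have [M_le1 | M_gt1] := leqP M 1; last first.
  (* [M] divides [n ^ d], so its least prime factor divides [n]. *)
  have p_le_M : (pdiv n <= M)%N.
    apply: leq_trans (pdiv_leq M_gt0).
    apply: pdiv_min_dvd (prime_gt1 (pdiv_prime M_gt1)) _.
    have : (pdiv M %| n ^ size rs)%N.
      by rewrite -M_dvd (dvdn_trans (pdiv_dvd M)) // dvdn_mulr.
    by rewrite Euclid_dvdX ?pdiv_prime // => /andP[].
  apply: (@leq_trans (M ^ n)); first by rewrite leq_exp2r.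
  rewrite -(ler_nat algC) -prodS natrX.
  have -> : (2 * n + 1)%:R ^+ size rs = \prod_(a <- rs) (2 * n + 1)%:R :> algC.
    by rewrite big_const_seq count_predT iter_mulr_1.
  rewrite big_seq [leRHS]big_seq; apply: ler_prod => a a_rs.
  by rewrite normr_ge0 norm_addS_bound ?psi_rs.
have M1 : M = 1%N by apply/eqP; rewrite eqn_leq M_le1.
exfalso; apply: (@recip_norm_unit_absurd n rs) => //.
  by rewrite -normr_prod DM M1.
have Eprod : (\prod_(a <- rs) (a + n%:R)) * N =
    n%:R ^+ size rs * \prod_(a <- rs) (1 + n%:R / a).
  rewrite -prod_nE -!big_split big_seq [RHS]big_seq; apply: eq_bigr => a a_rs /=.
  by have nz_a := nz_rs a a_rs; field.
have := congr1 Num.norm Eprod.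
rewrite !normrM normrX normr_nat DM M1 mulr1 normr_prod => ->.
(* A nonzero integer has norm at least 1. A zero factor [1 + n / a] would make [- n] a conjugate of
   [x]; being rational, it would equal [x], against nontriviality. *)
rewrite ler_peMr ?exprn_ge0 // norm_intr_ge1 // prodf_seq_neq0.
apply/allP => a a_rs /=; apply: contraNneq (nontrivial_root_addn_neq0 n x n_gt1 nt_x) => E0.
have Da : a = - n%:R.
  apply/eqP; rewrite -addr_eq0 -(mulIr_eq0 _ (mulIf (invr_neq0 (nz_rs a a_rs)))).
  by rewrite mulrDl divff ?nz_rs // E0.
rewrite (@Crat_conj_eq (- n%:R) x) ?addNr //.
- by rewrite rpredN rpred_nat.
- by rewrite -Da root_rs.
Qed.

End Roots.

(** * Passage to logarithms *)

Section RealBound.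

Local Open Scope R_scope.

Lemma INR_expn m k : INR (expn m k) = INR m ^ k.
Proof. by elim: k => [|k IHk] //; rewrite expnS mult_INR IHk. Qed.

(** The constant is what [2 n + 1 < e n] requires at [n = 2]. The proof uses
    [e = exp (1/8) ^ 8 >= (9/8) ^ 8], rounding down between squarings. *)
Lemma exp1_gt_5_2 : 5 / 2 < exp 1.
Proof.
have dbl x : exp x = exp (x / 2) * exp (x / 2).
  by rewrite -exp_plus; congr exp; lra.
have := exp_ineq1_le (1 / 2 / 2 / 2); rewrite (dbl 1) (dbl (1 / 2)) (dbl (1 / 2 / 2)).
set e := exp _ => le_e; have e_ge : 9 / 8 <= e by lra.
have e2_ge : 81 / 64 <= e * e by nra.
have e4_ge : 8 / 5 <= (e * e) * (e * e) by nra.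
nra.
Qed.

(** Taking logarithms, [n ln p <= d ln (2 n + 1) < d (1 + ln n)]; strictness relies on [d > 0]. *)
Lemma delta_lt n d : (1 < n)%N -> (0 < d)%N ->
  (pdiv n ^ n <= (2 * n + 1) ^ d)%N -> delta n.+1 < INR d.
Proof.
move=> n_gt1 d_gt0 /ssrnat.leP/le_INR; rewrite !INR_expn.
have n_ge2 : 2 <= INR n by apply: (le_INR 2); apply/ssrnat.leP.
have d_pos : 0 < INR d by apply: (lt_INR 0); apply/ssrnat.ltP.
have p_pos : 0 < INR (pdiv n) by apply: (lt_INR 0); apply/ssrnat.ltP; apply: pdiv_gt0.
have -> : INR (2 * n + 1)%N = 2 * INR n + 1 by rewrite plus_INR mult_INR.
move=> le_pow; have : ln (INR (pdiv n) ^ n) <= ln ((2 * INR n + 1) ^ d).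
  by case: le_pow => [/(ln_increasing _ _ (pow_lt _ n p_pos))|->]; lra.
rewrite !ln_pow; try lra; move=> le_ln.
have ln_n : 0 < ln (INR n) by rewrite -ln_1; apply: ln_increasing; lra.
have lt_ln : ln (2 * INR n + 1) < 1 + ln (INR n).
  have e_gt := exp1_gt_5_2.
  have <- : ln (exp 1 * INR n) = 1 + ln (INR n) by rewrite ln_mult ?ln_exp //; lra.
  by apply: ln_increasing; nra.
rewrite /delta /=; apply: (Rmult_lt_reg_r (1 + ln (INR n))); first lra.
rewrite /Rdiv Rmult_assoc Rinv_l; nra.
Qed.

End RealBound.

Theorem mainTheorem6 (s : nat) (hs : (3 <= s)%N) (alpha : algC) :
  nontrivial_root s alpha -> Rlt (delta s) (INR (alg_degree alpha)).
Proof.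
case: s hs => [//|n] n_gt1 nt_alpha; apply: delta_lt => //.
  by rewrite /alg_degree -subn1 subn_gt0 size_minCpoly.
exact: pdiv_exp_le_degree.
Qed.
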